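(* Let $n,k$ be positive integers. Then the family $i^n_k=\{i[R]^n_k:M_{n^k}(R)\to MC_n(R)\}_{R\in\mathfrak{R}}$ is an injective natural transformation from the functor $M_{n^k}$ to the functor $MC_n$; that is, it is natural in $R$ and each component $i[R]^n_k$ is injective.
   Context: All rings are associative with $1$; ring morphisms preserve $1$; $\mathfrak{R}$ is the category of rings. $M_m(R)$ is the ring of $m\times m$ matrices over $R$, and for a ring morphism $f:R\to S$, $M_m(f):M_m(R)\to M_m(S)$ applies $f$ entrywise. For $n\ge 1$ let $\eta^n_R:R\to M_n(R)$, $\eta^n_R(a)_{ij}=a\delta_{ij}$ (scalar matrices). Identify $M_n(M_{n^k}(R))$ with $M_{n^{k+1}}(R)$ via block matrices. For $n$ fixed, consider the direct system indexed by $k\in\mathbb{N}=\{0,1,2,\dots\}$ with objects $M_{n^k}(R)$ (so $M_{n^0}(R)=R$) and connecting maps $\eta^n_{M_{n^k}(R)}:M_{n^k}(R)\to M_{n^{k+1}}(R)$ (sending $A$ to the block diagonal matrix with $n$ diagonal blocks equal to $A$) and their composites. The $n$-matricial closure $MC_n(R)$ is the direct limit of this system in $\mathfrak{R}$, with canonical morphisms $i[R]^n_k:M_{n^k}(R)\to MC_n(R)$. For a ring morphism $f:R\to S$, $MC_n(f):MC_n(R)\to MC_n(S)$ is the unique ring morphism with $MC_n(f)\circ i[R]^n_k=i[S]^n_k\circ M_{n^k}(f)$ for all $k\in\mathbb{N}$. *)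

(* Defs.v *)
(* MathComp world, with classical logic from boolp.  Rings are [pzRingType]:
   associative and unital, the zero ring being allowed. *)
From HB Require Import structures.
From mathcomp Require Import all_boot all_algebra generic_quotient boolp.

Set Implicit Arguments.
Unset Strict Implicit.
Unset Printing Implicit Defensive.

Import GRing.Theory.
Local Open Scope ring_scope.
Local Open Scope quotient_scope.

Record ringFunctor := RingFunctor {
  fobj :> pzRingType -> pzRingType;
  fmap : forall R S : pzRingType, {rmorphism R -> S} ->
           {rmorphism fobj R -> fobj S};
  fmap_id : forall (R : pzRingType) (x : fobj R),
    fmap (idfun : {rmorphism R -> R}) x = x;
  fmap_comp : forall (R S T : pzRingType) (g : {rmorphism S -> T})
    (f : {rmorphism R -> S}) (x : fobj R),
    fmap (g \o f : {rmorphism R -> T}) x = fmap g (fmap f x)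
}.

Definition is_natural (F G : ringFunctor)
    (a : forall R : pzRingType, {rmorphism F R -> G R}) : Prop :=
  forall (R S : pzRingType) (f : {rmorphism R -> S}),
    a S \o fmap F f =1 fmap G f \o a R.
Arguments is_natural F G a : clear implicits.

(* A direct system of rings indexed by the natural numbers is given by its
   one-step maps; the other connecting maps are their composites. *)
Record ringSeq := RingSeq {
  sobj :> nat -> pzRingType;
  sstep : forall k, {rmorphism sobj k -> sobj k.+1}
}.

Arguments sstep A {k} : rename.

(* The direct limit of rings, as a quotient of the disjoint union of the stages;
   its universal property is [dlim_universal]. *)
Section DirectLimit.
Variable A : ringSeq.
Local Notation AT := (fun k : nat => GRing.PzRing.sort (A k)).

Definition dsum : Type := {k : nat & AT k}.
HB.instance Definition _ := Choice.on dsum.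

Definition dstep (u : dsum) : dsum := Tagged AT (sstep A (tagged u)).

Definition dtag (u : dsum) : nat := tag u.

(* [iter i dstep u = iter j dstep v] says that [u] and [v] have the same image
   under the connecting maps at the common stage [i + tag u = j + tag v]. *)
Definition deqv (u v : dsum) : bool :=
  `[< exists i j : nat, iter i dstep u = iter j dstep v >].

Lemma deqv_refl : reflexive deqv.
Proof. by move=> u; apply/asboolP; exists 0%N, 0%N. Qed.

Lemma deqv_sym : symmetric deqv.
Proof.
by move=> u v; apply/asboolP/asboolP => -[i [j e]]; exists j, i; rewrite e.
Qed.

Lemma deqv_trans : transitive deqv.
Proof.
move=> v u w /asboolP[i [j e]] /asboolP[i' [j' e']]; apply/asboolP.
by exists (i' + i)%N, (j + j')%N; rewrite !iterD e -e' -!iterD addnC.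
Qed.

Canonical deqv_equiv := EquivRel deqv deqv_refl deqv_sym deqv_trans.

Definition dlim : Type := {eq_quot deqv}.
HB.instance Definition _ := Choice.on dlim.
HB.instance Definition _ := EqQuotient.on dlim.

Definition dinj (k : nat) (x : A k) : dlim := \pi_dlim (Tagged AT x : dsum).

Lemma dpiP (u v : dsum) :
  \pi_dlim u = \pi_dlim v <-> exists i j, iter i dstep u = iter j dstep v.
Proof. by split=> [/eqmodP/asboolP|h]; [|apply/eqmodP/asboolP]. Qed.

Lemma dpi_iter i u : \pi_dlim (iter i dstep u) = \pi_dlim u.
Proof. by apply/dpiP; exists 0%N, i. Qed.

Lemma dinj_step k (x : A k) : dinj (sstep A x) = dinj x.
Proof. exact: (dpi_iter 1 (Tagged AT x)). Qed.

Lemma tag_iter i u : dtag (iter i dstep u) = (i + dtag u)%N.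
Proof. by elim: i => //= i IH; rewrite addSn -IH. Qed.

Lemma repr_dinj k (x : A k) : exists i j,
  iter i dstep (repr (dinj x)) = iter j dstep (Tagged AT x).
Proof. by apply/dpiP; rewrite reprK. Qed.

Section BinOp.
Variable op : forall k, A k -> A k -> A k.
Hypothesis op_step : forall k (x y : A k),
  sstep A (op x y) = op (sstep A x) (sstep A y).

Definition dopt (u v : dsum) : dsum :=
  Tagged AT (op (tagged u) (tagged_as u v)).

(* The operands are first pushed to the common stage [dtag u + dtag v]. *)
Definition dop (z w : dlim) : dlim :=
  let: (u, v) := (repr z, repr w) in
  \pi_dlim (dopt (iter (dtag v) dstep u) (iter (dtag u) dstep v)).

Lemma doptE k (x y : A k) : dopt (Tagged AT x) (Tagged AT y) = Tagged AT (op x y).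
Proof. by rewrite /dopt tagged_asE. Qed.

Lemma dopt_step u v : dtag u = dtag v ->
  dstep (dopt u v) = dopt (dstep u) (dstep v).
Proof.
case: u v => [k x] [l y]; rewrite /dtag /= => e; case: l / e y => y.
by rewrite doptE /dstep /= doptE op_step.
Qed.

Lemma dopt_iter i u v : dtag u = dtag v ->
  iter i dstep (dopt u v) = dopt (iter i dstep u) (iter i dstep v).
Proof.
move=> e; elim: i => //= i ->; rewrite dopt_step //.
by rewrite !tag_iter e.
Qed.

Lemma dopt_pi p q u v : (p + dtag u = q + dtag v)%N ->
  \pi_dlim (dopt (iter (dtag v) dstep u) (iter (dtag u) dstep v)) =
  \pi_dlim (dopt (iter p dstep u) (iter q dstep v)).
Proof.
move=> e; apply/dpiP; exists p, (dtag v).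
rewrite !dopt_iter ?tag_iter //; last by rewrite addnC.
rewrite -!iterD; congr (dopt (iter _ _ _) (iter _ _ _)); first by rewrite addnC.
by rewrite e addnC.
Qed.

Lemma dopE k (x y : A k) : dop (dinj x) (dinj y) = dinj (op x y).
Proof.
rewrite /dop; have [i [i' ei]] := repr_dinj x; have [j [j' ej]] := repr_dinj y.
set u := repr _ in ei *; set v := repr _ in ej *.
have eu : iter (j' + i) dstep u = iter (j' + i') dstep (Tagged AT x).
  by rewrite !iterD ei.
have ev : iter (i' + j) dstep v = iter (j' + i') dstep (Tagged AT y).
  by rewrite iterD ej -iterD addnC.
rewrite (@dopt_pi (j' + i) (i' + j)).
  by rewrite eu ev -dopt_iter // dpi_iter doptE.
by rewrite -!tag_iter eu ev !tag_iter.
Qed.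
End BinOp.

Lemma dinj_rep1 (z : dlim) : exists k (x : A k), z = dinj x.
Proof.
exists (dtag (repr z)), (tagged (repr z)).
by rewrite /dinj taggedK reprK.
Qed.

Lemma dinj_raise i k (x : A k) : exists x' : A (i + k)%N, dinj x = dinj x'.
Proof.
elim: i => [|i [x' ->]]; first by exists x.
by exists (sstep A x'); rewrite dinj_step.
Qed.

Lemma dinj_rep2 (z w : dlim) : exists k (x y : A k), z = dinj x /\ w = dinj y.
Proof.
have [[k [x ->]] [l [y ->]]] := (dinj_rep1 z, dinj_rep1 w).
have [[x' ->] [y' ->]] := (dinj_raise l x, dinj_raise k y).
by exists (l + k)%N; case: (k + l)%N / (addnC l k) y' => y'; exists x', y'.
Qed.

Lemma dinj_rep3 (z w t : dlim) :
  exists k (a b c : A k), [/\ z = dinj a, w = dinj b & t = dinj c].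
Proof.
have [[k [x [y [-> ->]]]] [l [c ->]]] := (dinj_rep2 z w, dinj_rep1 t).
have [[x' ->] [y' ->]] := (dinj_raise l x, dinj_raise l y).
have [c' ->] := dinj_raise k c.
exists (l + k)%N; case: (k + l)%N / (addnC l k) c' => c'.
by exists x', y', c'.
Qed.

Definition dzero : dlim := @dinj 0 0.
Definition dunit : dlim := @dinj 0 1.
Definition dopp (z : dlim) : dlim := dinj (- tagged (repr z)).
Definition dadd : dlim -> dlim -> dlim := dop (fun k (x y : A k) => x + y).
Definition dmul : dlim -> dlim -> dlim := dop (fun k (x y : A k) => x * y).

Lemma daddE k (x y : A k) : dadd (dinj x) (dinj y) = dinj (x + y).
Proof. by apply: dopE => {}k {}x {}y; rewrite rmorphD. Qed.

Lemma dmulE k (x y : A k) : dmul (dinj x) (dinj y) = dinj (x * y).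
Proof. by apply: dopE => {}k {}x {}y; rewrite rmorphM. Qed.

Lemma dzeroE k : dzero = @dinj k 0.
Proof. by elim: k => // k ->; rewrite -dinj_step rmorph0. Qed.

Lemma dunitE k : dunit = @dinj k 1.
Proof. by elim: k => // k ->; rewrite -dinj_step rmorph1. Qed.

Lemma doppE k (x : A k) : dopp (dinj x) = dinj (- x).
Proof.
pose ng (u : dsum) : dsum := Tagged AT (- tagged u).
have ngi i u : ng (iter i dstep u) = iter i dstep (ng u).
  by elim: i => //= i <-; rewrite /ng /dstep /= rmorphN.
have [i [j e]] := repr_dinj x.
by apply/dpiP; exists i, j; rewrite -[LHS]ngi e ngi.
Qed.

Lemma daddA : associative dadd.
Proof.
move=> z w t; have [k [a [b [c [-> -> ->]]]]] := dinj_rep3 z w t.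
by rewrite !daddE addrA.
Qed.

Lemma daddC : commutative dadd.
Proof.
by move=> z w; have [k [a [b [-> ->]]]] := dinj_rep2 z w; rewrite !daddE addrC.
Qed.

Lemma dadd0 : left_id dzero dadd.
Proof.
by move=> z; have [k [a ->]] := dinj_rep1 z; rewrite (dzeroE k) daddE add0r.
Qed.

Lemma daddN : left_inverse dzero dopp dadd.
Proof.
move=> z; have [k [a ->]] := dinj_rep1 z.
by rewrite (dzeroE k) doppE daddE addNr.
Qed.

Lemma dmulA : associative dmul.
Proof.
move=> z w t; have [k [a [b [c [-> -> ->]]]]] := dinj_rep3 z w t.
by rewrite !dmulE mulrA.
Qed.

Lemma dmul1l : left_id dunit dmul.
Proof.
by move=> z; have [k [a ->]] := dinj_rep1 z; rewrite (dunitE k) dmulE mul1r.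
Qed.

Lemma dmul1r : right_id dunit dmul.
Proof.
by move=> z; have [k [a ->]] := dinj_rep1 z; rewrite (dunitE k) dmulE mulr1.
Qed.

Lemma dmulDl : left_distributive dmul dadd.
Proof.
move=> z w t; have [k [a [b [c [-> -> ->]]]]] := dinj_rep3 z w t.
by rewrite !(dmulE, daddE) mulrDl.
Qed.

Lemma dmulDr : right_distributive dmul dadd.
Proof.
move=> z w t; have [k [a [b [c [-> -> ->]]]]] := dinj_rep3 z w t.
by rewrite !(dmulE, daddE) mulrDr.
Qed.

HB.instance Definition _ := GRing.isPzRing.Build dlim
  daddA daddC dadd0 daddN dmulA dmul1l dmul1r dmulDl dmulDr.

Lemma dinj_is_zmod_morphism k : zmod_morphism (@dinj k).
Proof. by move=> x y; rewrite -daddE -doppE. Qed.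

Lemma dinj_is_monoid_morphism k : monoid_morphism (@dinj k).
Proof. by split=> [|x y]; [rewrite -dunitE | rewrite -dmulE]. Qed.

HB.instance Definition _ k :=
  GRing.isZmodMorphism.Build (A k) dlim (@dinj k) (@dinj_is_zmod_morphism k).
HB.instance Definition _ k :=
  GRing.isMonoidMorphism.Build (A k) dlim (@dinj k)
    (@dinj_is_monoid_morphism k).

Section Universal.
Variables (T : pzRingType) (g : forall k, {rmorphism A k -> T}).
Hypothesis g_step : forall k (x : A k), g k.+1 (sstep A x) = g k x.

(* The compatibility proof is an argument so that the ring morphism structure of
   the lift can be inferred from the term alone. *)
Definition dlift_of & (forall k (x : A k), g k.+1 (sstep A x) = g k x) :
  dlim -> T := fun z => g _ (tagged (repr z)).
Let dlift := dlift_of g_step.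

Lemma dlift_inj k (x : A k) : dlift (dinj x) = g k x.
Proof.
pose gt (u : dsum) := g _ (tagged u).
have gti i u : gt (iter i dstep u) = gt u.
  by elim: i => //= i <-; rewrite {1}/gt /dstep /= g_step.
have [i [j e]] := repr_dinj x.
by rewrite -[LHS](gti i) e gti.
Qed.

Lemma dlift_is_zmod_morphism : zmod_morphism dlift.
Proof.
move=> z w; have [k [x [y [-> ->]]]] := dinj_rep2 z w.
by rewrite -rmorphB !dlift_inj rmorphB.
Qed.

Lemma dlift_is_monoid_morphism : monoid_morphism dlift.
Proof.
split=> [|z w]; first by rewrite -(rmorph1 (@dinj 0)) dlift_inj rmorph1.
have [k [x [y [-> ->]]]] := dinj_rep2 z w.
by rewrite -rmorphM !dlift_inj rmorphM.
Qed.

HB.instance Definition _ :=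
  GRing.isZmodMorphism.Build dlim T (dlift_of g_step) dlift_is_zmod_morphism.
HB.instance Definition _ :=
  GRing.isMonoidMorphism.Build dlim T (dlift_of g_step)
    dlift_is_monoid_morphism.

Lemma dlift_unique (h h' : dlim -> T) :
  (forall k (x : A k), h (dinj x) = h' (dinj x)) -> h =1 h'.
Proof. by move=> e z; have [k [x ->]] := dinj_rep1 z. Qed.

Theorem dlim_universal :
  exists h : {rmorphism dlim -> T},
    (forall k (x : A k), h (dinj x) = g k x) /\
    (forall h' : {rmorphism dlim -> T},
       (forall k (x : A k), h' (dinj x) = g k x) -> h' =1 h).
Proof.
exists (dlift_of g_step); split=> [|h' e]; first exact: dlift_inj.
by apply: dlift_unique => k x; rewrite e; apply/esym/dlift_inj.
Qed.
End Universal.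
End DirectLimit.

Section BlockIdentification.
Variables (R : pzRingType) (n k : nat).

Lemma blockdim : (\sum_(i < n) n ^ k)%N = (n ^ k.+1)%N.
Proof. by rewrite sum_nat_const card_ord expnS. Qed.

(* The identification of M_n(M_{n^k}(R)) with M_{n^{k+1}}(R) by block matrices. *)
Definition flatten_mx (B : 'M['M[R]_(n ^ k)]_n) : 'M[R]_(n ^ k.+1) :=
  castmx (blockdim, blockdim) (\mxblock_(i < n, j < n) B i j).

Lemma flatten_mx_is_zmod_morphism : zmod_morphism flatten_mx.
Proof.
move=> B C; rewrite /flatten_mx; case: _ / blockdim; rewrite !castmx_id -mxblockB.
by apply: eq_mxblock => i j; rewrite !mxE.
Qed.

Lemma flatten_mx_is_monoid_morphism : monoid_morphism flatten_mx.
Proof.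
split=> [|B C]; rewrite /flatten_mx; case: _ / blockdim; rewrite !castmx_id.
  rewrite [RHS](_ : _ = \mxdiag_(i < n) (1%:M : 'M[R]_(n ^ k))).
    apply: eq_mxblock => i j; rewrite !mxE.
    by case: eqP => // _; rewrite conform_mx_id.
  by rewrite mxdiagZ.
rewrite [RHS]mul_mxblock; apply: eq_mxblock => i j.
by rewrite !mxE.
Qed.

HB.instance Definition _ := GRing.isZmodMorphism.Build
  'M['M[R]_(n ^ k)]_n 'M[R]_(n ^ k.+1) flatten_mx flatten_mx_is_zmod_morphism.
HB.instance Definition _ := GRing.isMonoidMorphism.Build
  'M['M[R]_(n ^ k)]_n 'M[R]_(n ^ k.+1) flatten_mx
  flatten_mx_is_monoid_morphism.

Lemma flatten_mx_bij : bijective flatten_mx.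
Proof.
exists (fun C => \matrix_(i, j)
  submxblock (castmx (esym blockdim, esym blockdim) C) i j) => [B|C].
  by apply/matrixP => i j; rewrite mxE /flatten_mx castmxK mxblockK.
rewrite /flatten_mx; case: _ / blockdim C => C; rewrite !castmx_id.
rewrite -[RHS]submxblockK; by apply: eq_mxblock => i j; rewrite mxE.
Qed.
End BlockIdentification.

Definition etaM (n : nat) (S : pzRingType) : {rmorphism S -> 'M[S]_n} :=
  @scalar_mx S n.

(* Stage [0] is the ring ['M[R]_1] of 1 x 1 matrices, identified with [R]. *)
Definition MCseq (n : nat) (R : pzRingType) : ringSeq :=
  @RingSeq (fun k => 'M[R]_(n ^ k))
    (fun k => @flatten_mx R n k \o @etaM n 'M[R]_(n ^ k)).

Definition MC (n : nat) (R : pzRingType) : pzRingType := dlim (MCseq n R).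

Definition MCin (n k : nat) (R : pzRingType) :
  {rmorphism 'M[R]_(n ^ k) -> MC n R} :=
  (@dinj (MCseq n R) k : {rmorphism MCseq n R k -> dlim (MCseq n R)}).

Section MatrixFunctor.
Variable m : nat.

Definition Mmap (R S : pzRingType) (f : {rmorphism R -> S}) :
  {rmorphism 'M[R]_m -> 'M[S]_m} := map_mx f.

Lemma Mmap_id (R : pzRingType) (x : 'M[R]_m) :
  Mmap (idfun : {rmorphism R -> R}) x = x.
Proof. by apply/matrixP => i j; rewrite mxE. Qed.

Lemma Mmap_comp (R S T : pzRingType) (g : {rmorphism S -> T})
    (f : {rmorphism R -> S}) (x : 'M[R]_m) :
  Mmap (g \o f : {rmorphism R -> T}) x = Mmap g (Mmap f x).
Proof. by apply/matrixP => i j; rewrite !mxE. Qed.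

Definition Mfun : ringFunctor :=
  @RingFunctor (fun R => 'M[R]_m) Mmap Mmap_id Mmap_comp.
End MatrixFunctor.

Section MCFunctor.
Variable n : nat.

Section Map.
Variables (R S : pzRingType) (f : {rmorphism R -> S}).

Definition MCcocone (k : nat) : {rmorphism MCseq n R k -> MC n S} :=
  MCin n k S \o Mmap (n ^ k) f.

Lemma flatten_mx_map k (B : 'M['M[R]_(n ^ k)]_n) :
  map_mx f (flatten_mx B) = flatten_mx (map_mx (map_mx f) B).
Proof.
rewrite /flatten_mx map_castmx; congr castmx.
by apply/matrixP => i j; rewrite !mxE.
Qed.

Lemma MCcoconeP k (x : MCseq n R k) :
  MCcocone k.+1 (sstep (MCseq n R) x) = MCcocone k x.
Proof.
rewrite /MCcocone /= /Mmap /= flatten_mx_map.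
rewrite [map_mx _ _](_ : _ = etaM n _ (map_mx f x)).
  exact: (@dinj_step (MCseq n S) k (map_mx f x)).
by rewrite [LHS]map_scalar_mx.
Qed.

(* The unique ring morphism characterized by [MCmap_in] and [MCmap_unique]. *)
Definition MCmap : {rmorphism MC n R -> MC n S} := dlift_of MCcoconeP.

Lemma MCmap_in k (x : 'M[R]_(n ^ k)) :
  MCmap (MCin n k R x) = MCin n k S (map_mx f x).
Proof. exact: (dlift_inj MCcoconeP). Qed.

Lemma MCmap_unique (h : {rmorphism MC n R -> MC n S}) :
  (forall k (x : 'M[R]_(n ^ k)), h (MCin n k R x) = MCin n k S (map_mx f x)) ->
  h =1 MCmap.
Proof.
by move=> e; apply: dlift_unique => k x; rewrite [LHS]e [RHS]MCmap_in.
Qed.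
End Map.

Lemma MCmap_id (R : pzRingType) (x : MC n R) :
  MCmap (idfun : {rmorphism R -> R}) x = x.
Proof.
apply/esym; move: x; apply: (@MCmap_unique _ _ idfun idfun) => k x.
by congr (MCin n k R _); apply/matrixP => i j; rewrite mxE.
Qed.

Lemma MCmap_comp (R S T : pzRingType) (g : {rmorphism S -> T})
    (f : {rmorphism R -> S}) (x : MC n R) :
  MCmap (g \o f : {rmorphism R -> T}) x = MCmap g (MCmap f x).
Proof.
apply/esym; move: x.
apply: (@MCmap_unique _ _ (g \o f) (MCmap g \o MCmap f)) => k x.
rewrite -[LHS]/(MCmap g (MCmap f (MCin n k R x))) !MCmap_in.
by rewrite -map_mx_comp.
Qed.

Definition MCfun : ringFunctor :=
  @RingFunctor (MC n) MCmap MCmap_id MCmap_comp.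
End MCFunctor.

(* Main.v *)
Require Import Defs.
From mathcomp Require Import all_boot all_algebra.

(** Naturality is the equation [MCmap_in] characterizing [MCmap]. For injectivity, two elements of
    one stage with equal images in the limit already agree after finitely many connecting maps, and
    these are injective: a block diagonal matrix with [n > 0] equal blocks determines its block. *)

Lemma dstep_inj (A : ringSeq) :
  (forall k, injective (@sstep A k)) -> injective (@dstep A).
Proof.
move=> sinj [k x] [l y] e.
have ekl : k = l by have /(congr1 (@dtag A)) [] := e.
case: l / ekl y e => y /eqP.
by rewrite /dstep -tag_eqE /tag_eq eqxx tagged_asE => /eqP /sinj /= ->.
Qed.

Lemma dinj_inj (A : ringSeq) (k : nat) :
  (forall k, injective (@sstep A k)) -> injective (@dinj A k).
Proof.
move=> sinj x y /dpiP [i [j e]].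
(* Both sides lie in the same stage, so [i + k = j + k]. *)
have eij : i = j.
  by have /(congr1 (@dtag A)) := e; rewrite !tag_iter => /addIn.
case: j / eij e => e.
elim: i e => [/eqP|i IH /(dstep_inj A sinj) //].
by rewrite -tag_eqE /tag_eq eqxx tagged_asE => /eqP.
Qed.

Lemma MCseq_step_inj (n : nat) (R : pzRingType) (k : nat) :
  0 < n -> injective (@sstep (MCseq n R) k).
Proof.
move=> n_gt0 x y /(bij_inj (@flatten_mx_bij R n k)) /matrixP e.
(* Since [n > 0], there is a diagonal block to compare: the one at position (0, 0). *)
by have := e (Ordinal n_gt0) (Ordinal n_gt0); rewrite !mxE eqxx.
Qed.

Theorem proposition4 (n k : nat) (n_gt0 : 0 < n) (k_gt0 : 0 < k) :
  is_natural (Mfun (n ^ k)) (MCfun n) (MCin n k) /\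
  (forall R : pzRingType, injective (MCin n k R)).
Proof.
split=> [R S f x | R]; first by rewrite [RHS](@MCmap_in n R S f k x).
by apply: dinj_inj => l; apply: MCseq_step_inj.
Qed.
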